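(* Let $d\ge 4$ and $n\ge d^2+1$ be integers. Then the circulant graph $C_n^{1,d}$ is not a square.
   Context: For integers $1\le d_1<\dots<d_s\le n/2$, the circulant graph $C_n^{d_1,\dots,d_s}$ has vertex set $\{0,1,\dots,n-1\}$, with $i$ and $j$ adjacent iff $i-j\equiv \pm d_k \pmod n$ for some $1\le k\le s$. All graphs are finite and simple. A partially labeled graph is a graph $H$ together with an injective map $\theta: L\to V(H)$, $L\subseteq\mathbb{N}$, whose image $\theta(L)$ is nonempty and a proper subset of $V(H)$; vertices in $\theta(L)$ are labeled. The square $HH$ is obtained from two disjoint copies of $H$ by identifying each labeled vertex $\theta(\ell)$ of the first copy with $\theta(\ell)$ of the second copy (keeping all edges, merging double edges). A graph $G$ is a square if $G\cong HH$ for some partially labeled graph $H$. *)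

(* Defs.v *)
From mathcomp Require Import all_boot finmap.

Set Implicit Arguments.
Unset Strict Implicit.
Unset Printing Implicit Defensive.

Record sgraph := SGraph {
  vertex :> finType;
  adj : rel vertex;
  adj_sym : symmetric adj;
  adj_irr : irreflexive adj }.

Definition isomorphic (G G' : sgraph) : Prop :=
  exists2 f : G -> G', bijective f & {mono f : x y / adj x y}.

Section Circulant.
Variables (n : nat) (ds : seq nat).

(* [i - j = +-d mod n], written without subtraction. The conjunct [i != j] only
   makes the definition total: see [circulant_adjE]. *)
Definition circulant_adj : rel 'I_n := fun i j =>
  (i != j) &&
  has (fun d => (i == j + d %[mod n]) || (i + d == j %[mod n])) ds.

Lemma circulant_adj_sym : symmetric circulant_adj.
Proof.
move=> i j; rewrite /circulant_adj eq_sym; congr (_ && _).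
apply: eq_has => d /=; rewrite orbC.
by rewrite [_ == _ + _ %[mod _]]eq_sym [j == _ %[mod _]]eq_sym.
Qed.

Lemma circulant_adj_irr : irreflexive circulant_adj.
Proof. by move=> i; rewrite /circulant_adj eqxx. Qed.

Definition circulant : sgraph := SGraph circulant_adj_sym circulant_adj_irr.

Lemma circulant_adjE (i j : 'I_n) :
  all (fun d => (0 < d) && (d.*2 <= n)) ds ->
  circulant_adj i j =
  has (fun d => (i == j + d %[mod n]) || (i + d == j %[mod n])) ds.
Proof.
move=> /allP ds_ok; rewrite /circulant_adj; case: eqVneq => //= <-.
apply/esym/hasPn => d /ds_ok /andP[d_gt0 le_dn].
have lt_dn : d < n by apply: leq_trans le_dn; rewrite -addnn -addn1 leq_add2l.
rewrite [i == _ %[mod _]]eq_sym orbb -[X in _ == X %[mod _]]addn0 eqn_modDl.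
by rewrite mod0n modn_small // -lt0n.
Qed.

End Circulant.

(* The label set [L] is injected into the finite type [V(H)], hence finite. *)
Record plgraph := PLGraph {
  pl_graph :> sgraph;
  label_set : {fset nat};
  theta : label_set -> pl_graph;
  theta_inj : injective theta;
  theta_nonempty : [set theta l | l : label_set] != set0;
  theta_proper : [set theta l | l : label_set] \proper [set: pl_graph] }.

Definition labeled (H : plgraph) : {set H} := [set theta l | l : label_set H].

Section Square.
Variable H : plgraph.

Definition two_copies_adj (x y : H + H) : bool :=
  match x, y with
  | inl u, inl v | inr u, inr v => adj u v
  | _, _ => false
  end.

Definition forget_copy (x : H + H) : H :=
  match x with inl u | inr u => u end.

Definition identified : rel (H + H)%type := fun x y =>
  (x == y) || (forget_copy x == forget_copy y) && (forget_copy x \in labeled H).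

Lemma identified_equiv : {in [set: H + H] & &, equivalence_rel identified}.
Proof.
move=> x y z _ _ _; rewrite /identified; split; first by rewrite eqxx.
case/predU1P=> [-> //|/andP[/eqP exy lx]].
rewrite -exy lx !andbT.
case: (eqVneq x z) => [<-|_]; first by rewrite eqxx !orbT.
by case: (eqVneq y z) => [<-|//]; rewrite exy eqxx.
Qed.

Definition square_classes : {set {set H + H}} :=
  equivalence_partition identified [set: H + H].

Definition square_vertex : finType := {A | A \in square_classes}.

Definition square_adj : rel square_vertex := fun A B =>
  [exists x in val A, exists y in val B, two_copies_adj x y].

Lemma square_adj_sym : symmetric square_adj.
Proof.
have adjC x y : two_copies_adj x y = two_copies_adj y x.
  by case: x y => [u|u] [v|v] //=; exact: adj_sym.
suff sub A B : square_adj A B -> square_adj B A by move=> A B; apply/idP/idP; exact: sub.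
case/exists_inP=> x xA /exists_inP[y yB xy].
by apply/exists_inP; exists y => //; apply/exists_inP; exists x => //; rewrite adjC.
Qed.

Lemma square_adj_irr : irreflexive square_adj.
Proof.
have same z x : identified z x -> forget_copy z = forget_copy x.
  by case/predU1P=> [-> //|/andP[/eqP]].
case=> A A_cls; apply/exists_inP => -[x /= xA /exists_inP[y /= yA xy]].
case/imsetP: A_cls xA yA => z _ ->; rewrite !inE /= => /same zx /same zy.
by case: x y zx zy xy => [u|u] [v|v] //= -> ->; rewrite adj_irr.
Qed.

Definition square : sgraph := SGraph square_adj_sym square_adj_irr.

End Square.

Definition is_square (G : sgraph) : Prop :=
  exists H : plgraph, isomorphic G (square H).

(* Main.v *)
Require Import Defs.
From mathcomp Require Import all_boot.
From mathcomp Require Import all_algebra ring zify.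

Set Implicit Arguments.
Unset Strict Implicit.
Unset Printing Implicit Defensive.

(** A square carries the involution exchanging its two copies: it fixes exactly
    the labeled vertices, and no edge joins the two copies of the unlabeled part.
    In [C_n^{1,d}] under the given bounds, [x] is the only common neighbour of
    [x - 1] and [x + 1], whereas two non-opposite neighbours of a vertex have a
    second common neighbour.  Hence an automorphism fixing [p] has the form
    [p + x |-> p + x * u] with [u] in [{1, -1, d, -d}].  Since it is an involution
    and [d ^ 2 < n], it is the identity or [p + x |-> p - x]; but in the latter
    case the path [p + 1, ..., p + (d - 1), p - 1] joins the two copies while
    avoiding all fixed points. *)

(** [A] stands for lying in the first copy. It is constrained only at vertices moved by [phi], since
    a labeled vertex lies in both copies. *)
Definition copy_swap (G : sgraph) (phi : G -> G) (A : pred G) : Prop :=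
  [/\ involutive phi, {mono phi : x y / adj x y},
      {in [pred x | phi x != x] &, forall x y, adj x y -> A x = A y} &
      {in [pred x | phi x != x], forall x, A (phi x) = ~~ A x}].

(** * The copy-exchanging involution of a square *)

Section SquareInvolution.
Variable H : plgraph.
Implicit Types (x y : H + H) (C : square H).

Definition square_class x : square H :=
  Sub [set y in [set: H + H] | identified x y]
      (imset_f (fun z => [set y in [set: H + H] | identified z y]) (in_setT x)).

Lemma in_square_class x y : (y \in val (square_class x)) = identified x y.
Proof. by rewrite !inE. Qed.

Lemma square_class_eq x y : (square_class x == square_class y) = identified x y.
Proof.
have equivR := @identified_equiv H; apply/eqP/idP => [exy|xy].
  by rewrite -in_square_class exy in_square_class /identified eqxx.
apply: val_inj; apply/setP=> z; rewrite !in_square_class.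
by have [_ ->] := equivR x y z (in_setT _) (in_setT _) (in_setT _).
Qed.

Lemma square_class_surj C : exists x, square_class x == C.
Proof.
case: C => A A_cls; have /imsetP[x _ eA] := A_cls.
by exists x; apply/eqP; apply: val_inj; rewrite /= eA.
Qed.

Definition other_copy x : H + H :=
  match x with inl u => inr u | inr u => inl u end.

Definition first_copy x : bool := if x is inl _ then true else false.

Lemma other_copyK : involutive other_copy. Proof. by case. Qed.

Lemma forget_other_copy x : forget_copy (other_copy x) = forget_copy x.
Proof. by case: x. Qed.

Lemma identified_other_copy x y :
  identified (other_copy x) (other_copy y) = identified x y.
Proof.
by rewrite /identified !forget_other_copy (inj_eq (can_inj other_copyK)).
Qed.

Lemma two_copies_adj_other_copy x y :
  two_copies_adj (other_copy x) (other_copy y) = two_copies_adj x y.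
Proof. by case: x y => u [v|v]. Qed.

Lemma identified_unlabeled x y :
  forget_copy x \notin labeled H -> identified x y -> y = x.
Proof. by rewrite /identified => /negPf->; rewrite andbF orbF => /eqP. Qed.

Lemma square_repr_exists : exists repr : square H -> H + H, cancel repr square_class.
Proof.
by exists (fun C => xchoose (square_class_surj C)) => C;
  exact/eqP/(xchooseP (square_class_surj C)).
Qed.

Lemma square_swap_exists : exists swap : square H -> square H,
  forall x, swap (square_class x) = square_class (other_copy x).
Proof.
have [repr reprK] := square_repr_exists.
exists (fun C => square_class (other_copy (repr C))) => x.
by apply/eqP; rewrite square_class_eq identified_other_copy -square_class_eq reprK.
Qed.

Lemma square_class_adj_other_copy x y :
  adj (square_class x) (square_class y) ->
  adj (square_class (other_copy x)) (square_class (other_copy y)).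
Proof.
case/exists_inP=> x' + /exists_inP[y' + xy]; rewrite !in_square_class => xx yy.
apply/exists_inP; exists (other_copy x').
  by rewrite in_square_class identified_other_copy.
apply/exists_inP; exists (other_copy y').
  by rewrite in_square_class identified_other_copy.
by rewrite two_copies_adj_other_copy.
Qed.

(** An unlabeled element is alone in its class, so an edge between two such classes is an edge
    between the elements themselves, and [two_copies_adj] never joins different copies. *)
Lemma square_class_adj_unlabeled x y :
  forget_copy x \notin labeled H -> forget_copy y \notin labeled H ->
  adj (square_class x) (square_class y) -> first_copy x = first_copy y.
Proof.
move=> ux uy /exists_inP[x' + /exists_inP[y' + ]]; rewrite !in_square_class.
move=> /(identified_unlabeled ux)-> /(identified_unlabeled uy)->.
by case: x {ux}; case: y {uy}.
Qed.

Lemma square_copy_swap : exists (swap : square H -> square H) (A : pred (square H)),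
  [/\ copy_swap swap A, exists C, swap C = C & exists C, swap C != C].
Proof.
have [repr reprK] := square_repr_exists; have [swap swapE] := square_swap_exists.
have moved x : (swap (square_class x) != square_class x)
             = (forget_copy x \notin labeled H).
  rewrite swapE square_class_eq /identified forget_other_copy eqxx /=.
  by case: x.
have repr_unlabeled x :
    forget_copy x \notin labeled H -> repr (square_class x) = x.
  by move/identified_unlabeled; apply; rewrite -square_class_eq reprK.
have swapK : involutive swap.
  by move=> C; rewrite -[C]reprK !swapE other_copyK.
have swap_adj C D : adj C D -> adj (swap C) (swap D).
  rewrite -[C]reprK -[D]reprK !swapE; exact: square_class_adj_other_copy.
(* On unlabeled classes, which are singletons, the representative determines the copy; on labeled
   classes the value is arbitrary. *)
exists swap, (first_copy \o repr); split.
- split=> // [C D|C D|C].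
  + apply/idP/idP; last exact: swap_adj.
    by move/swap_adj; rewrite !swapK.
  + rewrite !inE -[C]reprK -[D]reprK !moved => uC uD.
    by rewrite /= !repr_unlabeled //; apply: square_class_adj_unlabeled.
  + rewrite inE -[C]reprK moved => uC /=.
    rewrite swapE !repr_unlabeled ?forget_other_copy //.
    by case: (repr C).
- have /set0Pn[v lv] := theta_nonempty H.
  by exists (square_class (inl v)); apply/eqP; rewrite -[_ == _]negbK moved lv.
- have /properP[_ [v _ ulv]] := theta_proper H.
  by exists (square_class (inl v)); rewrite moved.
Qed.

End SquareInvolution.

Lemma is_square_copy_swap (G : sgraph) : is_square G ->
  exists (phi : G -> G) (A : pred G),
    [/\ copy_swap phi A, exists p, phi p = p & exists q, phi q != q].
Proof.
case=> H [f [g fK gK] f_adj].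
have [swap [A [[swapK swap_adj A_adj A_swap] [C swapC] [D swapD]]]] :=
  square_copy_swap H.
have moved x : (g (swap (f x)) != x) = (swap (f x) != f x).
  by rewrite -[X in _ != X]fK (inj_eq (can_inj gK)).
exists (fun x => g (swap (f x))), (fun x => A (f x)); split.
- split=> [x|x y|x y|x]; first by rewrite /= gK swapK fK.
  + by rewrite /= -f_adj !gK swap_adj f_adj.
  + by rewrite !inE !moved -f_adj; apply: A_adj.
  + by rewrite inE moved gK; apply: A_swap.
- by exists (g C); rewrite gK swapC.
- by exists (g D); rewrite moved gK.
Qed.

Import GRing.Theory.

(** * Adjacency in the circulant graph as arithmetic in Z/n *)

Section CirculantRing.
Local Open Scope ring_scope.
Variables (m d : nat).
Local Notation Zn := 'I_m.+2.

Definition steps : seq Zn := [:: 1; -1; d%:R; - d%:R].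

(** Congruences become equations in the ring Z/n, with n written as [m.+2] so that [Zn] is a
    nontrivial ring. *)
Lemma modn_eq_ord (i j : Zn) k : (i == j + k %[mod m.+2])%N = (i == j + k%:R).
Proof.
by rewrite -val_eqE /= Zp_nat /= modnDmr (modn_small (ltn_ord i)).
Qed.

Lemma circulant_adj_steps (x y : Zn) :
  (0 < d)%N -> (d.*2 <= m.+2)%N ->
  adj (x : circulant m.+2 [:: 1%N; d]) y = (x - y \in steps).
Proof.
move=> d_gt0 le_dn; rewrite /= circulant_adjE /=; last by rewrite d_gt0 le_dn; lia.
have subE (c : Zn) : (x - y == c) = (x == y + c) by rewrite subr_eq addrC.
have subNE (c : Zn) : (x - y == - c) = (y == x + c).
  by rewrite -opprB eqr_opp subr_eq addrC.
rewrite orbF !inE ![(_ + _ == _ %[mod _])%N]eq_sym !modn_eq_ord.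
by rewrite !subNE !subE -!orbA.
Qed.

Lemma ord_natr_neq0 k : (0 < k < m.+2)%N -> k%:R != 0 :> Zn.
Proof.
case/andP=> k_gt0 k_lt; rewrite -val_eqE Zp_nat /= modn_small //.
by rewrite -lt0n.
Qed.

Hypotheses (d_ge4 : (4 <= d)%N) (n_gt : (d ^ 2 + 1 <= m.+2)%N).

Let n_ge : (4 * d + 1 <= m.+2)%N.
Proof. by apply: leq_trans n_gt; rewrite leq_add2r leq_mul2r d_ge4 orbT. Qed.

(** This yields the uniqueness of the common neighbour of [x - 1] and [x + 1]. Each of the other
    fifteen pairs would make some k vanish in Z/n, with k between 1 and 2d + 2, hence below n. *)
Lemma step_diff_eq2 s t : s \in steps -> t \in steps -> s - t = 2 -> s = 1 /\ t = -1.
Proof.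
have absurd k (P : Prop) (a b : Zn) : a = b -> a - b = k%:R \/ b - a = k%:R ->
    (0 < k < m.+2)%N -> P.
  by move=> -> + /ord_natr_neq0/eqP k0; rewrite subrr => -[] /esym /k0.
rewrite !inE.
case/or4P=> /eqP-> /or4P[] /eqP-> e.
- by apply: (absurd 2%N _ _ _ e); [right; ring | lia].
- by [].
- by apply: (absurd (d + 1)%N _ _ _ e); [right; ring | lia].
- by apply: (absurd (d - 1)%N _ _ _ e); [left; rewrite natrB; [ring|lia] | lia].
- by apply: (absurd 4%N _ _ _ e); [right; ring | lia].
- by apply: (absurd 2%N _ _ _ e); [right; ring | lia].
- by apply: (absurd (d + 3)%N _ _ _ e); [right; ring | lia].
- by apply: (absurd (d - 3)%N _ _ _ e); [left; rewrite natrB; [ring|lia] | lia].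
- by apply: (absurd (d - 3)%N _ _ _ e); [left; rewrite natrB; [ring|lia] | lia].
- by apply: (absurd (d - 1)%N _ _ _ e); [left; rewrite natrB; [ring|lia] | lia].
- by apply: (absurd 2%N _ _ _ e); [right; ring | lia].
- by apply: (absurd (2 * d - 2)%N _ _ _ e); [left; rewrite natrB; [ring|lia] | lia].
- by apply: (absurd (d + 3)%N _ _ _ e); [right; ring | lia].
- by apply: (absurd (d + 1)%N _ _ _ e); [right; ring | lia].
- by apply: (absurd (2 * d + 2)%N _ _ _ e); [right; ring | lia].
- by apply: (absurd 2%N _ _ _ e); [right; ring | lia].
Qed.

(** * Involutive automorphisms with a fixed point *)

Section Involution.
Variable phi : Zn -> Zn.
Hypotheses (phiK : involutive phi)
  (phi_steps : forall x y, (phi x - phi y \in steps) = (x - y \in steps)).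

Lemma phi_straight x : phi (x + 1) - phi x = phi x - phi (x - 1).
Proof.
set a := phi (x + 1) - phi x; set b := phi (x - 1) - phi x.
have aS : a \in steps by rewrite phi_steps addrAC subrr add0r inE eqxx.
have bS : b \in steps by rewrite phi_steps addrAC subrr add0r !inE eqxx orbT.
(* The fourth corner of the parallelogram on [phi x] with sides [a] and [b] is a common neighbour of
   the images of [x + 1] and [x - 1]. Its preimage [w] must then be [x], which forces
   [a + b = 0]. *)
pose w := phi (phi x + a + b).
have phiw : phi w = phi x + a + b by rewrite phiK.
have w1 : w - (x + 1) \in steps.
  by rewrite -phi_steps phiw (_ : _ - _ = b) // /a; ring.
have w2 : w - (x - 1) \in steps.
  by rewrite -phi_steps phiw (_ : _ - _ = a) // /b; ring.
have [|e _] := step_diff_eq2 w2 w1; first by ring.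
have ew : w = x by rewrite -[w](subrK (x - 1)) e; ring.
move: phiw; rewrite ew -addrA -[X in X = _]addr0 => /addrI /esym /eqP.
by rewrite addr_eq0 => /eqP ->; rewrite /b opprB.
Qed.

Variables (p : Zn) (phip : phi p = p).
Let u := phi (p + 1) - p.

(** By [phi_straight] consecutive increments of [phi] agree, so all of them equal the first one
    after [p], namely [u]. *)
Lemma phi_linear x : phi (p + x) = p + x * u.
Proof.
have slope k : phi (p + k%:R + 1) - phi (p + k%:R) = u.
  elim: k => [|k IHk]; first by rewrite addr0 phip.
  rewrite phi_straight (_ : p + k.+1%:R - 1 = p + k%:R); last by ring.
  by rewrite (_ : p + k.+1%:R = p + k%:R + 1) //; ring.
rewrite -[x](natr_Zp (x : 'Z_m.+2)); elim: (val x) => [|k IHk].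
  by rewrite mul0r !addr0.
rewrite (_ : p + k.+1%:R = p + k%:R + 1); last by ring.
by rewrite -[LHS](subrK (phi (p + k%:R))) slope IHk; ring.
Qed.

Lemma phi_multiplier : u = 1 \/ u = -1.
Proof.
(* Evaluate [phi] at [p + u], which is [phi (p + 1)]: linearity gives [p + u * u], involutivity
   gives [p + 1]. *)
have uu : u * u = 1.
  apply: (addrI p); rewrite -phi_linear -[X in _ = X]phiK.
  by congr phi; rewrite /u; ring.
have: u \in steps by rewrite /u -{2}phip phi_steps addrAC subrr add0r inE eqxx.
(* The quadratic bound on n enters here: 0 < d ^ 2 - 1 < n. It rules out both [d] and [-d] as values
   of [u]. *)
have d2 : d%:R * d%:R != 1 :> Zn.
  rewrite -subr_eq0 -natrM -(natrB _ (_ : 1 <= d * d)%N); last by lia.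
  apply: ord_natr_neq0; move: n_gt; rewrite -mulnn; nia.
rewrite !inE => /or4P[] /eqP eu; [by left | by right | |];
  by case/eqP: d2; move: uu; rewrite eu ?mulrNN.
Qed.

Lemma copy_swap_fixed_id (A : pred Zn) :
  (forall x y, phi x != x -> phi y != y -> x - y \in steps -> A x = A y) ->
  (forall x, phi x != x -> A (phi x) = ~~ A x) ->
  forall x, phi x = x.
Proof.
move=> A_adj A_swap x; rewrite -[x](subrKC p) phi_linear.
have [->|uN1] := phi_multiplier; first by rewrite mulr1.
have phiN y : phi (p + y) = p - y by rewrite phi_linear uN1 mulrN1.
have movedE y : (phi (p + y) != p + y) = (y *+ 2 != 0).
  rewrite phiN -subr_eq0 -oppr_eq0; congr (_ != 0); ring.
(* The reflection fixes [p + k] only if 2k = 0 in Z/n, but 0 < 2k < 2d < n. *)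
have moved k : (0 < k < d)%N -> phi (p + k%:R) != p + k%:R.
  move=> k_bnd; rewrite movedE -mulrnA; apply: ord_natr_neq0; lia.
have pathA k : (0 < k < d)%N -> A (p + k%:R) = A (p + 1).
  elim: k => // -[|k] IHk k_bnd //.
  rewrite -IHk; last by lia.
  apply: A_adj; [exact: moved | by apply: moved; lia |].
  by rewrite (_ : _ - _ = 1) ?inE ?eqxx //; ring.
have moved1 : phi (p + 1) != p + 1 by apply: (moved 1%N); lia.
have : A (p - 1) = A (p + 1).
  (* The path closes with a step of length [d], from [p + (d - 1)] to [p - 1]. *)
  rewrite -(pathA d.-1); last by lia.
  apply/esym/A_adj; first by apply: moved; lia.
    by rewrite movedE mulNrn oppr_eq0; apply: (@ord_natr_neq0 2); lia.
  rewrite (_ : _ - _ = d%:R) ?inE ?eqxx ?orbT //.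
  by rewrite -[in RHS](prednK (_ : 0 < d)%N); [ring | lia].
(* Since [p - 1] is the image of the moved vertex [p + 1], [A] must also differ at the two. *)
by rewrite -phiN A_swap //; case: (A _).
Qed.

End Involution.

End CirculantRing.

Theorem theorem4p12 (d n : nat) (hd : 4 <= d) (hn : d ^ 2 + 1 <= n) :
  ~ is_square (circulant n [:: 1; d]).
Proof.
case: n hn => [|[|m]] hn; [by lia | by nia |].
(* The moved vertex [q] reduces the contradiction to [phi q = q]. *)
case/is_square_copy_swap=> phi [A [[phiK phi_adj A_adj A_swap] [p phip] [q /eqP[]]]].
have [d_gt0 le_dn] : 0 < d /\ d.*2 <= m.+2 by nia.
have adjE x y := @circulant_adj_steps m d x y d_gt0 le_dn.
apply: (copy_swap_fixed_id hd hn phiK _ phip (A := A)) => [x y|x y mx my|x mx].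
- by rewrite -!adjE; apply: phi_adj.
- by rewrite -adjE; apply: A_adj.
- exact: A_swap.
Qed.
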